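(* For any $f \in L^2(\mathbb{R})$ and any $\epsilon > 0$ there exist $t > 0$, $N \in \mathbb{N}$ and $a_0, \dots, a_N \in \mathbb{R}$ such that $$\left\| f(x) - \sum_{n=0}^{N} a_n e^{-(x-nt)^2} \right\|_2 < \epsilon.$$
   Context: $L^2(\mathbb{R})$ denotes the space of square integrable functions $f:\mathbb{R}\to\mathbb{R}$ (real valued) with norm $\|f\|_2 := \sqrt{\int_{\mathbb{R}} |f(x)|^2\,dx}$. *)

(* Defs.v *)
From HB Require Import structures.
From mathcomp Require Import all_boot all_order all_algebra.
From mathcomp Require Import all_classical all_reals all_analysis.

Set Implicit Arguments.
Unset Strict Implicit.
Unset Printing Implicit Defensive.

Import Order.TTheory GRing.Theory Num.Theory.
Import numFieldNormedType.Exports.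

Local Open Scope ring_scope.

(* The completed measure lives on the sigma-algebra of Lebesgue measurable sets
   (Caratheodory sets, see [completed_caratheodory_measurable]), so all Lebesgue
   measurable functions are allowed; [lebesgue_measure] would restrict to Borel
   measurable ones. The elements of L^2 are functions, not classes. *)
Definition inL2 (R : realType) (f : R -> R) : Prop :=
  f \in Lfun (@completed_lebesgue_measure R) 2%:E.

(* Valued in [\bar R]: it equals [+oo] when |f|^2 has infinite integral. *)
Definition normL2 (R : realType) (f : R -> R) : \bar R :=
  'N[@completed_lebesgue_measure R]_2%:E[EFin \o f]%E.

(* Main.v *)
Require Import Defs.
From HB Require Import structures.
From mathcomp Require Import all_boot all_order all_algebra.
From mathcomp Require Import all_classical all_reals all_analysis.
From mathcomp Require Import measurable_realfun.
From mathcomp Require Import ring lra.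

Set Implicit Arguments.
Unset Strict Implicit.
Unset Printing Implicit Defensive.

Import Order.TTheory GRing.Theory Num.Theory.
Import numFieldNormedType.Exports HBNNSimple.

Local Open Scope classical_set_scope.
Local Open Scope ring_scope.

(** Since [expR (- (x - n t) ^+ 2)] is
    [expR (- (n t) ^+ 2) * expR (2 t x) ^+ n * expR (- x ^+ 2)], the linear
    combinations of the translates by [0, t, 2 t, ...] are exactly the products
    of the Gaussian [w x = expR (- x ^+ 2)] with a polynomial in
    [expR (2 t x)] ([gauss_fun_translate]). When [t] tends to 0,
    [(expR (2 t x) - 1) / (2 t)] tends to [x], and so every polynomial times [w]
    is an L2-limit of such products ([weighted_poly_sub_exp]). What remains is
    that the polynomials times [w] are dense in L2.

    Call V their closure. It is a linear space, stable under almost everywhere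
    limits of sequences that are dominated by a square integrable function
    ([L2_closure_lim]); everything below is such a limit. The weight [w] absorbs
    every exponential [expR (k |x|)], and the Taylor sums of the sine at [u] are
    bounded by [expR |u|], so that [q (sin (c (x - a))) * w x] is in V for every
    polynomial [q] ([L2_closure_sin]). Unlike polynomials, the sine is bounded:
    well-chosen polynomials [q n] with values in [0, 1] on [-1, 1] make
    [(q n) (sin ((x - a) / n.+1))] converge to the indicator of [x < a]
    ([cvg_step_poly_sin]), because the first zero of the sine on either side of
    [a] recedes to infinity as [n] grows. So V contains the indicators of the
    rays times [w] ([L2_closure_ray]). Rays form a pi-system that generates the
    Borel sets, and the sets whose indicator times [w] is in V form a Dynkin
    system, so V contains all Borel indicators times [w]
    ([L2_closure_preimage]), hence all Lebesgue measurable ones, which differ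
    from these on a null set. Finally, any square integrable [f] is the limit of
    [h n * w] for simple functions [h n] that approximate [f / w]
    ([square_integrable_L2_closure]).

    The rays are obtained over an abstract measure space with a measurable
    [X : T -> R] in place of the variable [x], and any weight that absorbs
    exponentials of [X]. *)



(** * Closure in L2 *)

Section L2_closure.
Context d (T : measurableType d) (R : realType).
Variable mu : {measure set T -> \bar R}.
Implicit Types (S : set (T -> R)) (e : R).

Local Notation norm2 f := ('N[mu]_2%:E[EFin \o f%R])%E.

Definition square_integrable (f : T -> R) :=
  mu.-integrable [set: T] (fun x => (f x ^+ 2)%:E).

(** Measurability belongs to the definition because the triangle inequality of
    the norm requires it; [S] may contain functions that are not measurable. *)
Definition L2_closure S : set (T -> R) :=
  [set f : T -> R | measurable_fun [set: T] f /\
  forall e : R, 0 < e -> exists u : T -> R,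
  [/\ S u, measurable_fun [set: T] u & (norm2 (f \- u) < e%:E)%E]].

(** The squared form is the one to which convergence theorems apply; the norm
    is the one that satisfies the triangle inequality. *)
Lemma norm2_ltP (f : T -> R) e : 0 < e ->
  (norm2 f < e%:E)%E <-> (\int[mu]_x (f x ^+ 2)%:E < (e ^+ 2)%:E)%E.
Proof.
move=> e0.
have -> : (\int[mu]_x (f x ^+ 2)%:E = norm2 f `^ 2)%E.
  rewrite poweR_Lnorm//; apply: eq_integral => x _ /=.
  by rewrite powR_mulrn// real_normK ?num_real.
have := Lnorm_ge0 mu 2%:E (EFin \o f).
case: (norm2 f)%E => [r||]//=; rewrite ?lee_fin => r0.
- by rewrite powR_mulrn// !lte_fin ltr_pXn2r// nnegrE ltW.
- by rewrite pnatr_eq0/= !ltNge !leey.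
Qed.

Lemma cvg_norm2_dominated (f : T -> R) (f_ : (T -> R)^nat) (G : T -> R) :
  measurable_fun [set: T] f -> (forall n, measurable_fun [set: T] (f_ n)) ->
  square_integrable G -> (forall n x, `|f_ n x| <= G x) ->
  {ae mu, forall x, f_ n x @[n --> \oo] --> f x} ->
  forall e, 0 < e -> exists n, (norm2 (f \- f_ n) < e%:E)%E.
Proof.
move=> mf mf_ iG f_G f_f e e0.
have [| | | | |_ _] := @dominated_convergence _ T R mu setT measurableT
  (fun n x => ((f x - f_ n x) ^+ 2)%:E) (cst 0%E)
  (fun x => 4%:E * (G x ^+ 2)%:E)%E.
- move=> n; apply/measurable_EFinP/measurable_funX.
  exact: measurable_funB.
- exact: measurable_cst.
- apply: filterS f_f => x f_fx _ /=.
  have : (f x - f_ n x) ^+ 2 @[n --> \oo] --> (f x - f x) ^+ 2.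
    have fB : f x - f_ n x @[n --> \oo] --> f x - f x.
      by apply: cvgB => //; exact: cvg_cst.
    by rewrite expr2; under eq_fun do rewrite expr2; exact: cvgM.
  by rewrite subrr expr0n/= => ?; apply: cvg_EFin => //; exact: nearW.
- exact: integrableZl.
(* Both [f] and [f_ n] are bounded by [G], whence the constant 4. *)
- apply: filterS f_f => x f_fx n _; rewrite gee0_abs ?lee_fin ?sqr_ge0//.
  have fG : `|f x| <= G x.
    rewrite -(cvg_lim _ (cvg_norm f_fx))//.
    apply: limr_le; last exact: nearW.
    by apply/cvg_ex; exists `|f x|; exact: cvg_norm.
  have := f_G n x; move: fG; rewrite /= !ler_norml.
  by move=> /andP[? ?] /andP[? ?]; nra.
rewrite integral_cst// mul0e => /fine_cvgP[fin0 /cvgr_lt/(_ (e ^+ 2))].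
rewrite exprn_gt0// => /(_ isT) ltn0.
near \oo => n; exists n; apply/norm2_ltP => //.
rewrite -[ltLHS]fineK; first by rewrite lte_fin; near: n.
by near: n.
Unshelve. all: by end_near. Qed.

Lemma sub_L2_closure S (f : T -> R) :
  measurable_fun [set: T] f -> S f -> L2_closure S f.
Proof.
move=> mf Sf; split => // e e0; exists f; split => //.
apply/norm2_ltP => //; under eq_integral do rewrite /= subrr expr0n.
by rewrite integral0 lte_fin exprn_gt0.
Qed.

Lemma norm2_ltD (f g : T -> R) e : measurable_fun [set: T] f ->
  measurable_fun [set: T] g -> (norm2 f < (e / 2)%:E)%E ->
  (norm2 g < (e / 2)%:E)%E -> (norm2 (f \+ g) < e%:E)%E.
Proof.
move=> mf mg fe ge; rewrite (le_lt_trans (minkowski_EFin _ _ _ _)) ?ler1n//.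
by rewrite [e in ltRHS]splitr (EFinD (e / 2)) lteD.
Qed.

Lemma L2_closure_trans S S' : S `<=` L2_closure S' ->
  L2_closure S `<=` L2_closure S'.
Proof.
move=> SS' f [mf fS]; split => // e e0.
have e20 : 0 < e / 2 by rewrite divr_gt0.
have [u [Su mu_ fu]] := fS _ e20.
have [_ /(_ _ e20)[v [Sv mv uv]]] := SS' _ Su.
exists v; split => //.
rewrite (_ : f \- v = (f \- u) \+ (u \- v)).
  by apply: norm2_ltD fu uv; exact: measurable_funB.
by apply/funext => x /=; rewrite addrA subrK.
Qed.

Lemma L2_closure_lim S (f : T -> R) (f_ : (T -> R)^nat) (G : T -> R) :
  measurable_fun [set: T] f -> (forall n, L2_closure S (f_ n)) ->
  square_integrable G -> (forall n x, `|f_ n x| <= G x) ->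
  {ae mu, forall x, f_ n x @[n --> \oo] --> f x} -> L2_closure S f.
Proof.
move=> mf f_S iG f_G f_f.
apply: (@L2_closure_trans (range f_)); first by move=> _ [n _ <-].
split => // e e0.
have mf_ n : measurable_fun setT (f_ n) by have [] := f_S n.
have [n fn] := cvg_norm2_dominated mf mf_ iG f_G f_f e0.
by exists (f_ n); split => //; exists n.
Qed.

Lemma L2_closureD S (f g : T -> R) : (forall u v, S u -> S v -> S (u \+ v)) ->
  L2_closure S f -> L2_closure S g -> L2_closure S (f \+ g).
Proof.
move=> SD [mf fS] [mg gS]; split; first exact: measurable_funD.
move=> e e0.
have e20 : 0 < e / 2 by rewrite divr_gt0.
have [u [Su mu_ fu]] := fS _ e20; have [v [Sv mv gv]] := gS _ e20.
exists (u \+ v); split; [exact: SD|exact: measurable_funD|].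
rewrite (_ : _ \- _ = (f \- u) \+ (g \- v)).
  by apply: norm2_ltD fu gv; exact: measurable_funB.
by apply/funext => x /=; ring.
Qed.

Lemma L2_closureZ S (f : T -> R) (a : R) : (forall u, S u -> S (a \*o u)) ->
  L2_closure S f -> L2_closure S (a \*o f).
Proof.
move=> SZ [mf fS]; split; first exact: measurable_funM.
move=> e e0.
(* [`|a| + 1] rather than [`|a|] avoids a division by zero. *)
have b0 : 0 < `|a| + 1 by rewrite ltr_wpDl.
have [u [Su mu_ fu]] := fS (e / (`|a| + 1)) (divr_gt0 e0 b0).
exists (a \*o u); split; [exact: SZ|exact: measurable_funM|].
move/norm2_ltP : fu => /(_ (divr_gt0 e0 b0)) fu; apply/norm2_ltP => //.
rewrite (_ : (fun x => _) =
    fun x => ((a ^+ 2)%:E * ((f x - u x) ^+ 2)%:E)%E); last first.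
  by apply/funext => x /=; rewrite -EFinM; congr EFin; ring.
rewrite ge0_integralZl_EFin//; last 3 first.
- by move=> x _; rewrite lee_fin sqr_ge0.
- by apply/measurable_EFinP/measurable_funX; exact: measurable_funB.
- exact: sqr_ge0.
have : (((`|a| + 1) ^+ 2)%:E * \int[mu]_x ((f x - u x) ^+ 2)%:E
    < (e ^+ 2)%:E)%E.
  rewrite -lte_pdivlMl ?exprn_gt0//.
  by rewrite -EFinM mulrC -exprVn -exprMn.
apply: le_lt_trans; rewrite lee_wpmul2r//.
  by apply: integral_ge0 => x _; rewrite lee_fin sqr_ge0.
rewrite lee_fin -[leLHS]real_normK ?num_real// ler_sqr ?nnegrE// ?ltW//.
by rewrite ltrDl.
Qed.

Lemma square_integrableZ (f : T -> R) (a : R) :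
  square_integrable f -> square_integrable (fun x => a * f x).
Proof.
move=> /(integrableZl measurableT (a ^+ 2)).
by apply: eq_integrable => // x _; rewrite -EFinM exprMn.
Qed.

End L2_closure.

(** * Real sequences *)

Section real_sequences.
Context {R : realType}.
Implicit Types (x v z : R).

Lemma cvg_divS v : v / n.+1%:R @[n --> \oo] --> (0 : R).
Proof.
rewrite -[X in _ --> X](mulr0 v); apply: cvgM; first exact: cvg_cst.
exact: cvg_harmonic.
Qed.

(** Applied to the exponential, this recovers a variable from exponentials of
    small multiples of it; applied to the sine, it says how fast
    [sin (v / n.+1%:R)] leaves 0. *)
Lemma cvg_rescaled_increment (f : R -> R) (df v : R) :
  is_derive (0 : R) 1 f df ->
  n.+1%:R * (f (v / n.+1%:R) - f 0) @[n --> \oo] --> v * df.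
Proof.
move=> fdf.
have [->|v0] := eqVneq v 0.
  under eq_fun do rewrite mul0r subrr mulr0.
  by rewrite mul0r; exact: cvg_cst.
have h0 : v / n.+1%:R @[n --> \oo] --> 0^'.
  move=> A /(cvg_divS v) [N _ NA]; exists N => // n /NA/=; apply.
  by rewrite mulf_neq0// invr_eq0 pnatr_eq0.
have fD : h^-1 *: (f (h *: 1 + 0) - f 0) @[h --> 0^'] --> df.
  by have [dv <-] := fdf; exact: dv.
rewrite (_ : (fun n => _) = fun n => v * ((v / n.+1%:R)^-1 *:
    (f ((v / n.+1%:R) *: 1 + 0) - f 0))).
  apply: cvgM; first exact: cvg_cst.
  exact: (cvg_comp _ _ h0 fD).
apply/funext => n.
by rewrite /GRing.scale/= mulr1 addr0 mulrA invfM invrK mulrA divff// mul1r.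
Qed.

Lemma norm_horner_le (p : {poly R}) (y b : R) : `|y| <= b -> 1 <= b ->
  `|p.[y]| <= (\sum_(i < size p) `|p`_i|) * b ^+ size p.
Proof.
move=> yb b1; rewrite horner_coef (le_trans (ler_norm_sum _ _ _))// mulr_suml.
apply: ler_sum => i _; rewrite normrM ler_wpM2l// normrX.
rewrite (@le_trans _ _ (b ^+ i))// ?lerXn2r ?nnegrE ?(le_trans _ yb)//.
by rewrite ler_weXn2l// ltnW.
Qed.

Lemma bernoulli_1B z n : 0 <= z <= 1 -> 1 - n%:R * z <= (1 - z) ^+ n.
Proof.
move=> /andP[z0 z1]; elim: n => [|n ih]; first by rewrite mul0r subr0 expr0.
rewrite exprS (le_trans _ (ler_wpM2l _ ih)) ?subr_ge0//.
rewrite -natr1 -subr_ge0.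
rewrite (_ : _ - _ = n%:R * z ^+ 2); first by rewrite mulr_ge0// sqr_ge0.
ring.
Qed.

Lemma norm_expRB1_le x : `|expR x - 1| <= `|x| * expR `|x|.
Proof.
have [x0|x0] := leP 0 x.
  rewrite [`|x|]ger0_norm// ger0_norm ?subr_ge0 -?expR0 ?ler_expR//.
  have := expR_ge1Dx (- x); rewrite expRN -div1r ler_pdivlMr ?expR_gt0//.
  by rewrite mulrDl mul1r mulNr expR0 lerBlDl addrC -lerBlDl.
have ex1 : expR x <= 1 by rewrite -expR0 ler_expR ltW.
rewrite [`|x|]ltr0_norm// ler0_norm ?subr_le0// opprB.
rewrite (@le_trans _ _ (- x))//.
  by rewrite lerBlDl -lerBlDr opprK expR_ge1Dx.
by rewrite ler_peMr ?oppr_ge0 ?ltW// -expR0 ltr_expR oppr_gt0.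
Qed.

(** The terms of the sine series are, in absolute value, among those of the
    exponential series at [`|x|]. *)
Lemma sin_partial_le x n : `|series (sin_coeff x) n| <= expR `|x|.
Proof.
rewrite (@le_trans _ _ (series (exp_coeff `|x|) n))//; last first.
  rewrite /expR nondecreasing_cvgn_le//; last exact: is_cvg_series_exp_coeff.
  by apply: nondecreasing_series => i _ _; exact: exp_coeff_ge0.
rewrite /series/= (le_trans (ler_norm_sum _ _ _))// ler_sum// => i _.
rewrite !normrM normfV !normr_nat normrX normrN normr1 expr1n mulr1.
rewrite /exp_coeff/= normrX ler_wpM2r ?invr_ge0//.
by case: odd; rewrite ?mul1r// mul0r exprn_ge0.
Qed.

Lemma cvg_sin_partial x : series (sin_coeff x) n @[n --> \oo] --> sin x.
Proof. by rewrite unlock; exact: is_cvg_series_sin_coeff. Qed.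

(** With [K = n.+1 ^ 2], this is [z |-> (1 - y ^+ K) ^+ (K * 2 ^ K)] at
    [y = (1 + z) / 2], a variant of the polynomials used to separate points in
    proofs of the Stone-Weierstrass theorem. It compares [K * 2 ^ K * y ^+ K],
    which is [K * (1 + z) ^+ K], with 1: the value is close to 1 when this
    product is small and close to 0 when it is large. The factor [K] in the
    exponent makes [z = 0] fall on the side of the value 0. *)
Definition step_poly n : {poly R} :=
  (1 - (2^-1 *: (1 + 'X)) ^+ (n.+1 ^ 2)) ^+ (n.+1 ^ 2 * 2 ^ (n.+1 ^ 2)).

Lemma step_polyE n z : (step_poly n).[z] =
  (1 - (2^-1 * (1 + z)) ^+ (n.+1 ^ 2)) ^+ (n.+1 ^ 2 * 2 ^ (n.+1 ^ 2)).
Proof. by rewrite /step_poly !hornerE. Qed.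

Let half_pow_itv n z : -1 <= z <= 1 -> 0 <= (2^-1 * (1 + z)) ^+ n <= 1.
Proof.
move=> /andP[z0 z1].
have y0 : 0 <= 2^-1 * (1 + z) by lra.
by rewrite exprn_ge0//= exprn_ile1//; lra.
Qed.

Lemma step_poly_itv n z : -1 <= z <= 1 -> 0 <= (step_poly n).[z] <= 1.
Proof.
move=> /(half_pow_itv (n.+1 ^ 2)) /andP[y0 y1].
by rewrite step_polyE exprn_ge0 ?exprn_ile1 ?subr_ge0// lerBlDr lerDl.
Qed.

Let step_exponentE K z :
  (K * 2 ^ K)%:R * (2^-1 * (1 + z)) ^+ K = K%:R * (1 + z) ^+ K.
Proof.
rewrite natrM natrX -mulrA; congr (_ * _).
by rewrite -exprMn mulrA mulfV// mul1r.
Qed.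

(** From [1 - y <= expR (- y)], the value is at most
    [expR (- K * (1 + z) ^+ K)], which is at most [expR (- K)]. *)
Lemma step_poly_le n z : 0 <= z <= 1 -> (step_poly n).[z] <= n.+1%:R^-1.
Proof.
move=> /andP[z0 z1]; rewrite step_polyE.
set K := (n.+1 ^ 2)%N; set y := _ ^+ K.
have /andP[y0 y1] : 0 <= y <= 1.
  by apply: half_pow_itv; rewrite z1 andbT; lra.
rewrite (@le_trans _ _ (expR (- y) ^+ (K * 2 ^ K)))//.
  by rewrite lerXn2r// ?nnegrE ?expR_ge0 ?subr_ge0// expR_ge1Dx.
rewrite -expRM_natl mulrN step_exponentE expRN lef_pV2 ?posrE ?expR_gt0//.
rewrite (le_trans _ (expR_ge1Dx _))// ler_wpDl//.
rewrite (@le_trans _ _ (K%:R * 1))//.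
  by rewrite mulr1 ler_nat /K -[leqLHS]muln1 leq_mul.
by rewrite ler_wpM2l// exprn_ege1// lerDl.
Qed.

(** By Bernoulli's inequality the value is at least [1 - K * (1 + z) ^+ K], and
    [(1 + z) ^+ K <= expR (K * z) <= expR (- n.+1 * c)] while [K] is only
    quadratic in [n.+1]: the cubic term of the exponential series suffices. *)
Lemma step_poly_ge n z c : -1 <= z -> 0 < c -> n.+1%:R * z <= - c ->
  1 - 6 / c ^+ 3 * n.+1%:R^-1 <= (step_poly n).[z].
Proof.
move=> z1 c0 zc; rewrite step_polyE.
have z0 : z <= 0.
  rewrite -(@pmulr_rle0 _ n.+1%:R)// (le_trans zc)// oppr_le0 ltW//.
set K := (n.+1 ^ 2)%N.
rewrite (le_trans _ (bernoulli_1B _ _))//; last first.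
  by apply: half_pow_itv; rewrite z1/= (le_trans z0).
rewrite lerD2l lerN2 step_exponentE.
have t0 : 0 < n.+1%:R * c by rewrite mulr_gt0.
rewrite (@le_trans _ _ (K%:R * expR (- (n.+1%:R * c))))//.
  rewrite ler_wpM2l// (@le_trans _ _ (expR z ^+ K))//.
    by rewrite lerXn2r ?nnegrE ?expR_ge0 ?expR_ge1Dx// -(addrN 1) lerD2l.
  rewrite -expRM_natl ler_expR /K natrX expr2 -mulrA -mulrN ler_wpM2l//.
have et : (n.+1%:R * c) ^+ 3 / 6 <= expR (n.+1%:R * c).
  by rewrite (le_trans _ (expR_ge1Dxn 2 (ltW t0)))// lerDr.
rewrite expRN ler_pdivrMr ?expR_gt0//.
rewrite (le_trans _ (ler_wpM2l _ et))//; last first.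
  by rewrite mulr_ge0// divr_ge0// exprn_ge0// ltW.
rewrite /K natrX le_eqVlt; apply/orP; left; apply/eqP; field.
by rewrite !lt0r_neq0// ltr_wpDr.
Qed.

(** For large [n] the number [v / n.+1%:R] is close to 0, where the sine has the
    sign of its argument and size about [v / n.+1%:R]. The exponent
    [K = n.+1 ^ 2] grows faster than the sine decays. *)
Lemma cvg_step_poly_sin v :
  (step_poly n).[sin (v / n.+1%:R)] @[n --> \oo] --> ((v < 0)%R%:R : R).
Proof.
have v_0 := cvg_divS v.
have [v0|v0] := ltP v 0.
  pose c := - (v / 2).
  have c0 : 0 < c by rewrite /c; lra.
  have sinc : \forall n \near \oo, n.+1%:R * sin (v / n.+1%:R) <= - c.
    have sin'0 : is_derive (0 : R) 1 sin 1.
      by rewrite -[X in is_derive _ _ _ X]cos0; exact: is_derive_sin.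
    have := @cvg_rescaled_increment sin 1 v sin'0.
    rewrite sin0 mulr1; under eq_fun do rewrite subr0.
    move=> /cvgr_le; apply; rewrite /c; lra.
  apply: (@squeeze_cvgr _ _ _ _ (fun n => 1 - 6 / c ^+ 3 * n.+1%:R^-1) (cst 1)).
  - near=> n; apply/andP; split.
      apply: step_poly_ge => //; first exact: sin_geN1.
      by near: n.
    have /(step_poly_itv n)/andP[//] : -1 <= sin (v / n.+1%:R) <= 1.
    by rewrite sin_geN1 sin_le1.
  - rewrite -[X in _ --> X]subr0; apply: cvgB; first exact: cvg_cst.
    exact: cvg_divS.
  - exact: cvg_cst.
apply: (@squeeze_cvgr _ _ _ _ (cst 0) (fun n => n.+1%:R^-1)).
- near=> n; have vn : -1 <= sin (v / n.+1%:R) <= 1 by rewrite sin_geN1 sin_le1.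
  have /andP[-> _]/= := step_poly_itv n vn.
  apply: step_poly_le; rewrite sin_le1 andbT.
  have [->|v1] := eqVneq v 0; first by rewrite mul0r sin0.
  have v2 : v / n.+1%:R < 2 by near: n; move/cvgr_lt : v_0; apply.
  by apply/ltW/sin2_gt0; rewrite v2 divr_gt0// lt_neqAle eq_sym v1.
- exact: cvg_cst.
- exact: cvg_harmonic.
Unshelve. all: by end_near. Qed.

End real_sequences.

(** * Polynomials against a rapidly decaying weight *)

Section weighted_polynomials.
Context d (T : measurableType d) (R : realType).
Variable mu : {measure set T -> \bar R}.
Variables (X w : T -> R).
Hypotheses (mX : measurable_fun [set: T] X) (mw : measurable_fun [set: T] w).
Hypothesis w_ge0 : forall x, 0 <= w x.
Hypothesis w_exp : forall k : nat,
  square_integrable mu (fun x => expR (k%:R * `|X x|) * w x).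

Definition weighted_poly : set (T -> R) :=
  [set u | exists p : {poly R}, u = fun x => p.[X x] * w x].

Definition weighted_exp_poly : set (T -> R) :=
  [set u | exists (p : {poly R}) (t : R),
    0 < t /\ u = fun x => p.[expR (t * X x)] * w x].

Lemma square_integrable_weight : square_integrable mu w.
Proof.
by have := w_exp 0; apply: eq_integrable => // x _; rewrite mul0r expR0 mul1r.
Qed.

Lemma measurable_weighted (p : {poly R}) (y : T -> R) :
  measurable_fun [set: T] y -> measurable_fun [set: T] (fun x => p.[y x] * w x).
Proof.
move=> my; apply: measurable_funM => //.
apply: (@measurableT_comp _ _ _ _ _ _ (horner p)) => //.
exact: measurable_poly.
Qed.

Lemma weighted_polyD u v :
  weighted_poly u -> weighted_poly v -> weighted_poly (u \+ v).
Proof.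
move=> [p ->] [q ->]; exists (p + q).
by apply/funext => x /=; rewrite hornerD mulrDl.
Qed.

Lemma weighted_polyZ (a : R) u : weighted_poly u -> weighted_poly (a \*o u).
Proof.
move=> [p ->]; exists (a *: p).
by apply/funext => x /=; rewrite hornerZ mulrA.
Qed.

(** A polynomial of a sequence bounded by [expR (k |X| + c)] is bounded by
    another exponential of [|X|], which the weight absorbs: a pointwise limit is
    then a dominated one. *)
Lemma L2_closure_horner S (p : {poly R}) (y : T -> R) (y_ : nat -> T -> R)
    (k : nat) (c : R) : 0 <= c -> measurable_fun [set: T] y ->
  (forall n x, `|y_ n x| <= expR (k%:R * `|X x| + c)) ->
  (forall x, y_ n x @[n --> \oo] --> y x) ->
  (forall n, L2_closure mu S (fun x => p.[y_ n x] * w x)) ->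
  L2_closure mu S (fun x => p.[y x] * w x).
Proof.
move=> c0 my y_le y_y Sy.
pose C := \sum_(i < size p) `|p`_i|.
pose G x := (C * expR c ^+ size p) * (expR ((size p * k)%:R * `|X x|) * w x).
apply: (@L2_closure_lim _ _ _ _ _ _ _ G _ Sy).
- exact: measurable_weighted.
- exact: square_integrableZ.
- move=> n x; rewrite normrM (ger0_norm (w_ge0 x)) /G mulrA ler_wpM2r//.
  have b1 : 1 <= expR (k%:R * `|X x| + c).
    by rewrite -[leLHS]expR0 ler_expR addr_ge0 ?mulr_ge0.
  rewrite (le_trans (norm_horner_le p (y_le n x) b1))//.
  rewrite (natrM R (size p)) -(mulrA _ k%:R) (expRM_natl (size p)).
  by rewrite expRD exprMn mulrA mulrAC.
- apply: aeW => x; apply: cvgM; last exact: cvg_cst.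
  by apply: (cvg_comp _ _ (y_y x)); exact: continuous_horner.
Qed.

(** The approximants of [X] are the difference quotients
    [(expR (t X) - 1) / t] with [t = n.+1^-1], polynomials in [expR (t X)]. *)
Lemma weighted_poly_sub_exp :
  weighted_poly `<=` L2_closure mu weighted_exp_poly.
Proof.
move=> _ [p ->].
pose y_ n x := n.+1%:R * (expR (X x / n.+1%:R) - expR 0).
apply: (@L2_closure_horner _ p X y_ 2 0) => //.
- move=> n x; rewrite addr0 /y_ expR0 normrM normr_nat.
  rewrite (@le_trans _ _ (`|X x| * expR `|X x|))//; last first.
    rewrite expRM_natl expr2 ler_wpM2r ?expR_ge0//.
    by rewrite (le_trans _ (expR_ge1Dx _))// lerDr.
  rewrite (le_trans (ler_wpM2l _ (norm_expRB1_le _)))// mulrA normrM.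
  rewrite [`|_^-1|]ger0_norm// mulrCA mulfV// mulr1 ler_wpM2l// ler_expR.
  by rewrite ler_piMr// invf_le1// ler1n.
- move=> x; have := @cvg_rescaled_increment R expR 1 (X x).
  rewrite mulr1; apply; rewrite -[X in is_derive _ _ _ X]expR0.
  exact: is_derive_expR.
- move=> n; apply: sub_L2_closure.
    apply: measurable_weighted; apply: measurable_funM => //.
    apply: measurable_funB => //; apply: measurableT_comp => //.
    exact: measurable_funM.
  exists (p \Po (n.+1%:R *: ('X - 1))), n.+1%:R^-1; split => //.
  apply/funext => x; rewrite horner_comp !hornerE /y_ expR0.
  by rewrite [_^-1 * _]mulrC.
Qed.

(** The Taylor sums of the sine at [u] are bounded by [expR |u|], and
    [|u| <= |X| + |a|] for the argument [u] used here. *)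
Lemma L2_closure_sin (p : {poly R}) (a c : R) : `|c| <= 1 ->
  L2_closure mu weighted_poly (fun x => p.[sin (c * (X x - a))] * w x).
Proof.
move=> c1.
pose y_ n x := series (sin_coeff (c * (X x - a))) n.
apply: (@L2_closure_horner _ p _ y_ 1 `|a|) => //.
- apply: (@measurableT_comp _ _ _ _ _ _ sin).
    by apply: continuous_measurable_fun; exact: continuous_sin.
  by apply: measurable_funM => //; apply: measurable_funB.
- move=> n x; rewrite (le_trans (sin_partial_le _ _))// ler_expR normrM mul1r.
  by rewrite (le_trans (ler_wpM2r _ c1))// mul1r ler_normB.
- by move=> x; exact: cvg_sin_partial.
- move=> n; apply: sub_L2_closure.
    apply: measurable_weighted.
    apply: measurable_sum => i; under eq_fun do rewrite sin_coeffE.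
    apply: measurable_funM => //; apply: measurable_funX.
    by apply: measurable_funM => //; apply: measurable_funB.
  exists (p \Po \sum_(0 <= i < n) sin_coeff 1 i *: (c *: ('X - a%:P)) ^+ i).
  apply/funext => x; rewrite horner_comp horner_sum /y_ /series/=.
  congr (p.[_] * _); apply: eq_bigr => i _; rewrite !hornerE.
  by rewrite !sin_coeffE expr1n mulr1.
Qed.

Lemma measurable_preimage (A : set R) : measurable A -> measurable (X @^-1` A).
Proof. by move=> mA; rewrite -[_ @^-1` _]setTI; exact: mX. Qed.

Lemma L2_closure_ray (a : R) :
  L2_closure mu weighted_poly (fun x => \1_(X @^-1` [set` `]-oo, a[]) x * w x).
Proof.
pose f_ n x := (step_poly n).[sin (n.+1%:R^-1 * (X x - a))] * w x.
apply: (@L2_closure_lim _ _ _ _ _ _ f_ w).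
- apply: measurable_funM => //; apply: measurable_indic.
  exact: measurable_preimage.
- move=> n; apply: L2_closure_sin.
  by rewrite ger0_norm// invf_le1// ler1n.
- exact: square_integrable_weight.
- move=> n x; rewrite normrM (ger0_norm (w_ge0 x)) ler_piMl//.
  have : -1 <= sin (n.+1%:R^-1 * (X x - a)) <= 1 by rewrite sin_geN1 sin_le1.
  by move=> /(step_poly_itv n)/andP[? ?]; rewrite ger0_norm.
- apply: aeW => x; apply: cvgM; last exact: cvg_cst.
  rewrite indicE (_ : (x \in _) = (X x - a < 0)%R); last first.
    by apply/idP/idP; rewrite inE/= in_itv/= subr_lt0.
  under eq_fun do rewrite mulrC.
  exact: cvg_step_poly_sin.
Qed.

(** Dynkin's pi-lambda theorem, with the rays as pi-system; the domination
    needed for a disjoint union is by [w] itself. *)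
Lemma L2_closure_preimage (A : set R) : measurable A ->
  L2_closure mu weighted_poly (fun x => \1_(X @^-1` A) x * w x).
Proof.
move=> mA.
pose P A := L2_closure mu weighted_poly (fun x => \1_(X @^-1` A) x * w x).
have mind B : measurable B ->
    measurable_fun [set: T] (fun x => \1_(X @^-1` B) x * w x).
  move=> mB; apply: measurable_funM => //.
  exact/measurable_indic/measurable_preimage.
have w2 := square_integrable_weight.
have GE : @measurable _ R = <<s @RGenInftyO.G R >>.
  exact: RGenInftyO.measurableE.
apply: (@dynkin_induction _ _ (@RGenInftyO.G R) P).
- exact: GE.
- move=> _ _ [a ->] [b ->]; exists (Num.min a b).
  by apply/seteqP; split=> x /=; rewrite !in_itv/= lt_min;
    [case=> -> ->|move/andP].
- apply: sub_L2_closure; first exact: mind.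
  by exists 1; apply/funext => x; rewrite preimage_setT indicT hornerC.
- by move=> _ [a ->]; exact: L2_closure_ray.
- move=> B mB BS.
  rewrite /P (_ : (fun x => _) =
      w \+ (-1 \*o (fun x => \1_(X @^-1` B) x * w x))); last first.
    apply/funext => x /=; rewrite preimage_setC indicC indicE.
    by case: (_ \in _) => /=; ring.
  apply: L2_closureD; first exact: weighted_polyD.
    apply: sub_L2_closure => //.
    by exists 1; apply/funext => x; rewrite hornerC mul1r.
  by apply: L2_closureZ => //; exact: weighted_polyZ.
- move=> F mF tF FS.
  (* At most one term of the sum over [F] is nonzero at a given point. *)
  have in_F n i x : F i (X x) -> (x \in X @^-1` F n) = (n == i).
    move=> Fix; apply/idP/eqP => [|->]; rewrite inE//= => Fnx.
    by apply: (tF n i) => //; exists (X x).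
  have sum_in n i x : F i (X x) ->
      \sum_(j < n) (\1_(X @^-1` (F j)) x * w x) = (i < n)%N%:R * w x.
    move=> Fix; under eq_bigr do rewrite indicE (in_F _ i)//.
    rewrite -mulr_suml; congr (_ * _).
    have [ni|ni] := ltnP i n.
      rewrite (bigD1 (Ordinal ni))//= eqxx big1 ?addr0// => j.
      by rewrite -val_eqE/= => /negbTE ->.
    by rewrite big1// => j _; rewrite ltn_eqF// (leq_trans (ltn_ord j)).
  have sum_out n x : ~ (exists i, F i (X x)) ->
      \sum_(j < n) (\1_(X @^-1` (F j)) x * w x) = 0.
    move=> nF; apply: big1 => j _; rewrite indicE memNset ?mul0r//= => Fjx.
    by apply: nF; exists j.
  apply: (@L2_closure_lim _ _ _ _ _ _
    (fun n x => \sum_(i < n) (\1_(X @^-1` (F i)) x * w x)) w) => //.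
  + exact/mind/bigcup_measurable.
  + elim=> [|n ih].
      apply: sub_L2_closure.
        by under eq_fun do rewrite big_ord0; exact: measurable_cst.
      by exists 0; apply/funext => x; rewrite big_ord0 hornerC mul0r.
    under eq_fun do rewrite big_ord_recr/=.
    by apply: (L2_closureD _ ih (FS n)); exact: weighted_polyD.
  + move=> n x; have [[i Fix]|nF] := pselect (exists i, F i (X x)).
      rewrite (sum_in _ _ _ Fix) normrM (ger0_norm (w_ge0 x)) ler_piMl//.
      by rewrite normr_nat lern1 leq_b1.
    by rewrite sum_out// normr0.
  + apply: aeW => x; have [[i Fix]|nF] := pselect (exists i, F i (X x)).
      rewrite indicE mem_set; last by exists i.
      apply: (cvg_near_cst _ _); near=> n.
      rewrite (sum_in _ _ _ Fix) (_ : (i < n)%N)//; near: n.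
      exact: nbhs_infty_gt.
    rewrite indicE memNset; last by move=> [i _ Fix]; apply: nF; exists i.
    by under eq_fun do rewrite sum_out//; rewrite mul0r; exact: cvg_cst.
- by rewrite -GE.
Unshelve. all: by end_near. Qed.
End weighted_polynomials.

(** * From indicators to square integrable functions *)

Section indicators_to_L2.
Context d (T : measurableType d) (R : realType).
Variable mu : {measure set T -> \bar R}.
Variables (w : T -> R) (S : set (T -> R)).
Hypotheses (mw : measurable_fun [set: T] w) (w_gt0 : forall x, 0 < w x).
Hypothesis SD : forall u v, S u -> S v -> S (u \+ v).
Hypothesis SZ : forall (a : R) u, S u -> S (a \*o u).
Hypothesis indicS : forall E, measurable E ->
  L2_closure mu S (fun x => \1_E x * w x).

Lemma L2_closure_simple (h : {nnsfun T >-> R}) :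
  L2_closure mu S (fun x => h x * w x).
Proof.
have sumS (s : seq R) : L2_closure mu S
    (fun x => \sum_(y <- s) y * (\1_(h @^-1` [set y]) x * w x)).
  elim: s => [|y s ih].
    under eq_fun do rewrite big_nil.
    rewrite (_ : (fun=> 0) = 0 \*o (fun x : T => \1_[set: T] x * w x)).
      by apply: L2_closureZ; [exact: SZ|exact: indicS].
    by apply/funext => x /=; rewrite mul0r.
  under eq_fun do rewrite big_cons.
  apply: (L2_closureD SD _ ih); apply: L2_closureZ; first exact: SZ.
  exact: indicS.
under eq_fun do rewrite [h _]fimfunE fsbig_finite//= mulr_suml.
under eq_fun do under eq_bigr do rewrite -mulrA.
exact: sumS.
Qed.

(** Simple functions increasing to [f / w], once multiplied by [w], are
    dominated by [f]. *)
Lemma ge0_L2_closure (f : T -> R) : measurable_fun [set: T] f ->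
  (forall x, 0 <= f x) -> square_integrable mu f -> L2_closure mu S f.
Proof.
move=> mf f0 f2.
have mh : measurable_fun [set: T] (fun x => (f x / w x)%:E).
  apply/measurable_EFinP/measurable_funM => //.
  rewrite (_ : (fun x => _) = fun x => w x `^ (-1)); last first.
    by apply/funext => x; rewrite powR_inv1// ltW.
  exact: (@measurableT_comp _ _ _ _ _ _ (@powR R ^~ (-1))).
have h0 x : [set: T] x -> (0 <= (f x / w x)%:E)%E.
  by rewrite lee_fin divr_ge0// ltW.
pose h_ := nnsfun_approx measurableT mh.
apply: (@L2_closure_lim _ _ _ _ _ _ (fun n x => h_ n x * w x) f) => //.
- by move=> n; exact: L2_closure_simple.
- move=> n x; rewrite ger0_norm ?mulr_ge0 ?(ltW (w_gt0 x))//.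
  by rewrite -ler_pdivlMr// -lee_fin /h_ nnsfun_approxE; exact: le_approx.
- apply: aeW => x.
  rewrite -[X in _ --> X](@divfK _ (w x)) ?gt_eqF//.
  apply: cvgM; last exact: cvg_cst.
  have /fine_cvgP[_] := cvg_nnsfun_approx measurableT mh h0 (I : [set: T] x).
  exact.
Qed.

Lemma square_integrable_L2_closure (f : T -> R) : measurable_fun [set: T] f ->
  square_integrable mu f -> L2_closure mu S f.
Proof.
move=> mf f2.
have part (g : T -> R) : measurable_fun [set: T] g -> (forall x, 0 <= g x) ->
    (forall x, `|g x| <= `|f x|) -> L2_closure mu S g.
  move=> mg g0 gf; apply: ge0_L2_closure => //.
  apply: le_integrable f2 => //.
    by apply/measurable_EFinP; exact: measurable_funX.
  move=> x _; rewrite !gee0_abs ?lee_fin ?sqr_ge0//.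
  rewrite -[leLHS]real_normK ?num_real// -[leRHS]real_normK ?num_real//.
  by rewrite lerXn2r.
rewrite (_ : f = f^\+ \+ (-1) \*o f^\-); last first.
  by apply/funext => x /=; rewrite mulN1r -[in LHS](funrposBneg f).
have normE x : f^\+ x + f^\- x = `|f x|.
  by rewrite -[RHS]/((Num.norm \o f) x) -funrposDneg.
apply: (L2_closureD SD); last (apply: L2_closureZ; first exact: SZ).
- apply: part; first exact: measurable_funrpos.
    by move=> x; exact: funrpos_ge0.
  by move=> x; rewrite -normE ger0_norm ?funrpos_ge0// lerDl funrneg_ge0.
- apply: part; first exact: measurable_funrneg.
    by move=> x; exact: funrneg_ge0.
  by move=> x; rewrite -normE ger0_norm ?funrneg_ge0// lerDr funrpos_ge0.
Qed.

End indicators_to_L2.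

(** * The completed Lebesgue measure *)

Section lebesgue.
Context {R : realType}.
Local Notation leb := (@completed_lebesgue_measure R).
Local Notation lebT := (caratheodory_type (wlength (@idfun R))^*%mu).

Lemma measurable_id_completed :
  measurable_fun [set: lebT] (idfun : lebT -> measurableTypeR R).
Proof. by move=> _ A mA; rewrite setTI; apply: sub_caratheodory; exact: mA. Qed.

Lemma measurable_fun_completed (f : R -> R) : measurable_fun [set: R] f ->
  measurable_fun [set: lebT] (f : lebT -> R).
Proof. by move=> mf; exact: (measurableT_comp mf measurable_id_completed). Qed.

(** On Borel sets both measures coincide by construction, so the Lebesgue
    measure is the image of the completed one under the identity. *)
Lemma ge0_integral_completed (h : measurableTypeR R -> \bar R) :
  measurable_fun setT h -> (forall x, 0 <= h x)%E ->
  (\int[leb]_x h x = \int[lebesgue_measure]_x h x)%E.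
Proof.
move=> mh h0.
transitivity (\int[leb]_(x in (idfun : lebT -> measurableTypeR R) @^-1` setT)
  (h \o (idfun : lebT -> measurableTypeR R)) x)%E; first by [].
by rewrite -(ge0_integral_pushforward measurable_id_completed)//.
Qed.

Lemma integrable_gauss_completed :
  leb.-integrable [set: lebT] (EFin \o gauss_fun).
Proof.
have mg := @measurable_gauss_fun R.
apply/integrableP; split.
  by apply/measurable_EFinP; exact: measurable_fun_completed.
have /integrableP[_] := @integrableT_gauss R; apply: le_lt_trans.
rewrite -ge0_integral_completed//.
by apply: measurableT_comp => //; exact/measurable_EFinP.
Qed.

(** Completing the square: [2 k |x| - 2 x ^+ 2 <= k ^+ 2 - x ^+ 2]. *)
Lemma square_integrable_exp_gauss (k : nat) :
  square_integrable leb (fun x => expR (k%:R * `|x|) * gauss_fun x).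
Proof.
have i : leb.-integrable [set: lebT]
    (fun x => (expR (k%:R ^+ 2))%:E * (gauss_fun x)%:E)%E.
  exact/integrableZl/integrable_gauss_completed.
apply: le_integrable i => //.
  apply/measurable_EFinP; apply: measurable_fun_completed.
  apply: measurable_funX.
  apply: measurable_funM; last exact: measurable_gauss_fun.
  apply: (@measurableT_comp _ _ _ _ _ _ expR) => //.
  by apply: measurable_funM => //; exact: measurable_normr.
move=> x _; rewrite -EFinM !gee0_abs ?lee_fin ?sqr_ge0//; last first.
  by rewrite mulr_ge0 ?expR_ge0.
rewrite /gauss_fun -!expRD -expRM_natl ler_expR.
have : 0 <= (`|x| - k%:R) ^+ 2 by exact: sqr_ge0.
have : `|x| ^+ 2 = x ^+ 2 by rewrite real_normK ?num_real.
nra.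
Qed.

(** The Caratheodory sets are the unions of a Borel set and a negligible set. *)
Lemma completed_measurableP (E : set lebT) : measurable E ->
  exists A : set R, measurable A /\
    {ae leb, forall x, \1_E x = \1_A x :> R}.
Proof.
rewrite -[measurable E]/(_.-cara.-measurable E).
rewrite -completed_caratheodory_measurable g_sigma_completed_algebra_genE.
move=> [A mA [N [B [mB B0 NB]]] <-].
exists A; split => //; exists B; split => //.
  apply: sub_caratheodory; exact: mB.
move=> x; apply: contra_notP => Bx /=.
rewrite !indicE (_ : (x \in _ `|` _) = (x \in A))//.
by apply/idP/idP; rewrite !inE; [case=> // /NB|left].
Qed.

End lebesgue.

(** * The Gaussian weight *)

Section gauss.
Context {R : realType}.
Local Notation leb := (@completed_lebesgue_measure R).
Local Notation lebT := (caratheodory_type (wlength (@idfun R))^*%mu).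

Lemma L2_closure_indic_gauss (E : set lebT) : measurable E ->
  L2_closure leb (weighted_poly (idfun : lebT -> R) gauss_fun)
    (fun x => \1_E x * gauss_fun x).
Proof.
have mid : measurable_fun [set: lebT] (idfun : lebT -> R) :=
  measurable_id_completed.
have mg : measurable_fun [set: lebT] (gauss_fun : lebT -> R).
  by apply: measurable_fun_completed; exact: measurable_gauss_fun.
move=> mE; have [A [mA EA]] := completed_measurableP mE.
have AS := L2_closure_preimage mid mg (@gauss_fun_ge0 R)
  square_integrable_exp_gauss mA.
apply: (@L2_closure_lim _ _ _ leb _ _ (fun=> _) gauss_fun _ (fun=> AS)).
- by apply: measurable_funM => //; exact: measurable_indic.
- exact: (square_integrable_weight square_integrable_exp_gauss).
- move=> _ x; rewrite indicE normrM normr_nat (ger0_norm (gauss_fun_ge0 x)).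
  by rewrite ler_piMl ?gauss_fun_ge0// lern1 leq_b1.
- by apply: filterS EA => x ->; exact: cvg_cst.
Qed.

End gauss.

(** The parameter is [t / 2] so that the exponential on the right is that of
    [weighted_exp_poly]. *)
Lemma gauss_fun_translate (R : realType) (x t : R) n :
  expR ((n%:R * (t / 2)) ^+ 2) * expR (- (x - n%:R * (t / 2)) ^+ 2) =
  expR (t * x) ^+ n * gauss_fun x.
Proof. by rewrite -expRM_natl /gauss_fun -!expRD; congr expR; field. Qed.

Theorem theorem1 (R : realType) (f : R -> R) (eps : R) :
  inL2 f -> 0 < eps ->
  exists (t : R) (N : nat) (a : 'I_N.+1 -> R),
    0 < t /\
    (normL2 (fun x : R =>
       (f x - \sum_(n < N.+1) a n * expR (- (x - n%:R * t) ^+ 2))%R)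
     < eps%:E)%E.
Proof.
move=> fL2 eps0.
have mf := set_mem (sub_Lfun_mfun fL2).
have mid := @measurable_id_completed R.
have mg := measurable_fun_completed (@measurable_gauss_fun R).
have fS := square_integrable_L2_closure mg (fun x => expR_gt0 (- x ^+ 2))
  (@weighted_polyD _ _ _ idfun gauss_fun)
  (@weighted_polyZ _ _ _ idfun gauss_fun)
  L2_closure_indic_gauss mf (Lfun2_integrable_sqr fL2).
have [_ /(_ _ eps0)] := L2_closure_trans (weighted_poly_sub_exp mid mg
  (@gauss_fun_ge0 R) square_integrable_exp_gauss) fS.
move=> [_ [[p [t [t0 ->]]] _ fp]].
(* The coefficient of index [size p] is the default value 0 of [p`_n], so that
   the sum, which is never empty, represents also the zero polynomial. *)
exists (t / 2), (size p), (fun n => p`_n * expR ((n%:R * (t / 2)) ^+ 2)).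
split; first by rewrite divr_gt0.
rewrite /normL2; move: fp; congr (Lnorm _ _ _ < _)%E.
apply/funext => x /=; congr (_ - _)%:E.
rewrite (@horner_coef_wide _ (size p).+1)// mulr_suml; apply: eq_bigr => n _.
by rewrite -!mulrA gauss_fun_translate.
Qed.
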